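(* Let $\mathcal{I}$ be a tall ideal on $\omega$ and let $V$ be a proper vector subspace of $\mathbf{R}^\omega$ which contains $c_{00}(\mathcal{I})$. Then $V$ does not admit a locally convex FK topology.
   Context: $\omega$ is the set of nonnegative integers and $\mathbf{R}^\omega$ is the vector space of real sequences with the topology of pointwise convergence. A vector subspace $V\subseteq \mathbf{R}^\omega$ admits a locally convex FK topology if there is a topology $\tau$ on $V$ such that $(V,\tau)$ is a locally convex, completely metrizable topological vector space (i.e. a Fréchet space) and the inclusion map $V\to \mathbf{R}^\omega$ is continuous. An ideal $\mathcal{I}$ on $\omega$ is a proper (i.e. $\mathcal{I}\neq\mathcal{P}(\omega)$) hereditary collection of subsets of $\omega$ closed under finite unions; it is always assumed that $\mathcal{I}$ contains the family $\mathrm{Fin}$ of finite subsets of $\omega$. The ideal $\mathcal{I}$ is tall if every infinite subset of $\omega$ contains an infinite subset belonging to $\mathcal{I}$. Finally, $c_{00}(\mathcal{I}):=\{x\in\mathbf{R}^\omega: \mathrm{supp}\,x\in\mathcal{I}\}$, where $\mathrm{supp}\,x:=\{n\in\omega: x(n)\neq 0\}$. *)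

(* Defs.v *)
From HB Require Import structures.
From mathcomp Require Import all_boot all_order all_algebra.
From mathcomp Require Import all_classical all_reals all_analysis.

Set Implicit Arguments.
Unset Strict Implicit.
Unset Printing Implicit Defensive.

Import Order.TTheory GRing.Theory Num.Theory.
Import numFieldNormedType.Exports.

Local Open Scope classical_set_scope.
Local Open Scope ring_scope.

Definition is_ideal (I : set_system nat) : Prop :=
  [/\ I <> setT,
      forall A B : set nat, A `<=` B -> I B -> I A,
      forall A B : set nat, I A -> I B -> I (A `|` B) &
      forall A : set nat, finite_set A -> I A].

Definition tall (I : set_system nat) : Prop :=
  forall A : set nat, infinite_set A ->
    exists B : set nat, [/\ B `<=` A, infinite_set B & I B].

Definition supp (R : realType) (x : nat -> R) : set nat := [set n | x n != 0].

Definition c00 (R : realType) (I : set_system nat) : set (nat -> R) :=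
  [set x | I (supp x)].
Arguments c00 : clear implicits.

(* [R^o] is [R] seen as a vector space over itself, so that [nat -> R^o] is the
   vector space of real sequences, with pointwise operations. *)
Definition subspace_carrier (R : realType) (V : submodClosed (nat -> R^o)) :=
  {x : nat -> R^o | x \in V}.

Section subspace_carrier_lmod.
Context (R : realType) (V : submodClosed (nat -> R^o)).

HB.instance Definition _ := SubChoice.on (subspace_carrier V).
HB.instance Definition _ := [SubChoice_isSubLmodule of subspace_carrier V by <:].

End subspace_carrier_lmod.

Record topology_on (T : Type) := TopologyOn {
  topology_open : set_system T;
  topology_openT : topology_open setT;
  topology_openI : setI_closed topology_open;
  topology_open_bigU : forall (J : Type) (f : J -> set T),
    (forall j, topology_open (f j)) -> topology_open (\bigcup_j f j) }.

(* The vector space [E], seen as a topological space whose open sets are those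
   of [tau]. *)
Definition topologized (R : realType) (E : lmodType R) (tau : topology_on E)
  : Type := E.

Section topologized_instances.
Context (R : realType) (E : lmodType R) (tau : topology_on E).

HB.instance Definition _ := GRing.Lmodule.on (topologized tau).
HB.instance Definition _ := isOpenTopological.Build (topologized tau)
  (topology_openT tau) (@topology_openI _ tau) (@topology_open_bigU _ tau).

Lemma open_topologized (A : set (topologized tau)) :
  open A = topology_open tau A.
Proof. by []. Qed.

End topologized_instances.

(* The conditions are those under which [E] is a [tvsType R]. *)
Definition is_locally_convex_tvs (R : realType) (E : preTopologicalLmodType R)
  : Prop :=
  [/\ continuous (fun x : E * E => x.1 + x.2),
      continuous (fun z : R^o * E => z.1 *: z.2) &
      exists2 B : set_system E,
        (forall b, b \in B -> convex_set b) & basis B].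

Definition is_metric (R : realType) (T : Type) (d : T -> T -> R) : Prop :=
  [/\ forall x, d x x = 0,
      forall x y, d x y = 0 -> x = y,
      forall x y, d x y = d y x &
      forall x y z, d x z <= d x y + d y z].

Definition completely_metrizable (R : realType) (T : topologicalType) : Prop :=
  exists d : T -> T -> R,
    [/\ is_metric d,
        forall x : T, nbhs x = nbhs_ball_ (fun y e => [set z | d y z < e]) x &
        forall u : nat -> T,
          (forall e : R, 0 < e -> exists N : nat, forall m n : nat,
             (N <= m)%N -> (N <= n)%N -> d (u m) (u n) < e) ->
          exists l : T, u @ \oo --> l].

Definition admits_locally_convex_FK (R : realType)
    (V : submodClosed (nat -> R^o)) : Prop :=
  exists tau : topology_on (subspace_carrier V),
    [/\ is_locally_convex_tvs (topologized tau),
        completely_metrizable R (topologized tau) &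
        continuous (fun x : topologized tau => \val x : {ptws nat -> R^o})].

(* Main.v *)
(* Let U be a neighbourhood of 0 in an FK topology on V, and let e_n be the n-th
   unit sequence. If B is in I then every sequence supported in B lies in V, and
   a closed graph argument shows that U contains all sequences supported in a
   cofinite part of B; in particular it contains the line
   R e_n for all but finitely many n in B. Tallness then gives R e_n in U for
   all but finitely many n, since an infinite exceptional set would contain an
   infinite member of I. Hence, by local convexity, the series
   sum x_n e_n is Cauchy for every real sequence x; by completeness it converges
   in V, and its limit has the coordinates of x, so V is everything.

   The complete metric is not assumed to be translation invariant; that
   Cauchy sequences of the vector topology converge is a theorem of Klee. *)
Require Import Defs.
From HB Require Import structures.
From mathcomp Require Import all_boot all_order all_algebra.
From mathcomp Require Import all_classical all_reals all_analysis.
From mathcomp Require Import lra.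

Set Implicit Arguments.
Unset Strict Implicit.
Unset Printing Implicit Defensive.

Import Order.TTheory GRing.Theory Num.Theory.
Import numFieldNormedType.Exports.

Local Open Scope classical_set_scope.
Local Open Scope ring_scope.

(** * Convergence of additively Cauchy sequences under a complete metric that need not be
    invariant *)

Lemma geometric_steps_converge (R : realType) (T : topologicalType)
    (d : T -> T -> R) (y : nat -> T) :
  is_metric d ->
  (forall u : nat -> T,
    (forall e : R, 0 < e -> exists N : nat, forall m n : nat,
       (N <= m)%N -> (N <= n)%N -> d (u m) (u n) < e) ->
    exists l : T, u @ \oo --> l) ->
  (forall n, d (y n) (y n.+1) < 2^-1 ^+ n) ->
  exists l : T, y @ \oo --> l.
Proof.
move=> [d0 _ dC dT] d_complete y_step; apply: d_complete => e e0.
(* Subtracting the rest of the geometric series makes the induction on [k] close. *)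
have bound n k : d (y n) (y (n + k)%N) <= 2 * 2^-1 ^+ n - 2 * 2^-1 ^+ (n + k).
  elim: k => [|k IHk]; first by rewrite addn0 d0 subrr.
  rewrite addnS (le_trans (dT _ (y (n + k)%N) _))// exprS.
  have := y_step (n + k)%N; lra.
have pos n : 0 < (2^-1 : R) ^+ n by rewrite exprn_gt0.
(* Both points lie within [2 * 2^-1 ^+ N] of [y N], so [2^-1 ^+ N < e / 4] suffices. *)
have e4 : 0 < e / 4 by rewrite divr_gt0.
have [N _ small] := near_infty_natSinv_expn_lt (PosNum e4).
have {small} /= small := small N (leqnn N); rewrite div1r -exprVn in small.
exists N => m n /subnKC <- /subnKC <-.
have := dT (y (N + (m - N))%N) (y N) (y (N + (n - N))%N).
rewrite (dC _ (y N)).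
have := bound N (m - N)%N; have := bound N (n - N)%N.
have := pos (N + (m - N))%N; have := pos (N + (n - N))%N.
lra.
Qed.

Lemma nbhs_translate (M : topologicalZmodType) (a : M) (A : set M) :
  nbhs a A -> nbhs 0 [set v | A (a + v)].
Proof.
move=> aA; have /= := @add_continuous M (a, 0) A; rewrite addr0 => /(_ aA).
move=> [[P Q] [/= aP Q0] PQ]; apply: filterS Q0 => v Qv.
by apply: (PQ (a, v)); split => //=; exact: nbhs_singleton.
Qed.

Lemma nbhs_sub (M : topologicalZmodType) (a : M) (A : set M) :
  nbhs 0 A -> nbhs a [set z | A (z - a)].
Proof.
move=> A0; have /= := @sub_continuous M (a, a) A; rewrite subrr => /(_ A0).
move=> [[P Q] [/= aP aQ] PQ]; apply: filterS aP => z Pz.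
by apply: (PQ (z, a)); split => //=; exact: nbhs_singleton.
Qed.

Lemma nbhs0_split (M : topologicalZmodType) (U : set M) : nbhs 0 U ->
  exists2 D : set M, nbhs 0 D &
    forall a b, D a -> D b -> U (a + b) /\ U (a - b).
Proof.
move=> U0.
have /= := @add_continuous M (0, 0) U; rewrite addr0 => /(_ U0).
move=> [[P1 P2] /= [P10 P20] PU].
have /= := @sub_continuous M (0, 0) U; rewrite subr0 => /(_ U0).
move=> [[Q1 Q2] /= [Q10 Q20] QU].
exists ((P1 `&` P2) `&` (Q1 `&` Q2)); first by do !apply: filterI.
move=> a b [[? ?] [? ?]] [[? ?] [? ?]].
by split; [apply: (PU (a, b))|apply: (QU (a, b))]; split.
Qed.

Definition additively_cauchy (M : topologicalZmodType) (s : nat -> M) :=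
  forall U : set M, nbhs 0 U -> exists N : nat, forall m n : nat,
    (N <= m)%N -> (N <= n)%N -> U (s m - s n).

(* The sequence [s] has a subsequence of the form [y n + y n.+1] in which
   [y n.+2] is as [d]-close as desired to [y n]: the increment of [s] is added to
   [y n], and it was made small with respect to [y n] one step earlier. So the
   even and the odd terms of [y] both converge by completeness of [d]. *)
Lemma completely_metrizable_cauchy_cvg (R : realType)
    (M : topologicalZmodType) (s : nat -> M) :
  completely_metrizable R M -> additively_cauchy s ->
  exists l : M, s @ \oo --> l.
Proof.
move=> [d [d_metric d_nbhs d_complete]] s_cauchy.
have tail (a : M) (e : R) (k : nat) : 0 < e -> exists k', (k <= k')%N /\
    forall j, (k' <= j)%N -> d a (a + (s j - s k')) < e.
  move=> e0; have aB : nbhs a [set z | d a z < e] by rewrite d_nbhs; exists e.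
  have [N sN] := s_cauchy _ (nbhs_translate aB).
  exists (maxn k N); split; first exact: leq_maxl.
  by move=> j kj; apply: sN (leq_trans (leq_maxr _ _) kj) (leq_maxr _ _).
(* Along the sequence [f] of states [(a, b, k, n)], [b] is [y n], [a] is the preceding term (0 at
   the start), and [a + b = s k]. The last clause bounds the step from [y n] to [y n.+2] in advance,
   whatever later index is chosen. *)
pose next_rel (p q : M * M * nat * nat) :=
  [/\ q.1.1.1 = p.1.1.2, q.1.1.2 = p.1.1.1 + (s q.1.2 - s p.1.2),
      (maxn p.1.2 p.2 <= q.1.2)%N, q.2 = p.2.+1 &
      forall j, (q.1.2 <= j)%N ->
        d p.1.1.2 (p.1.1.2 + (s j - s q.1.2)) < 2^-1 ^+ p.2].
have next p : {q | next_rel p q}.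
  have e0 : 0 < (2^-1 : R) ^+ p.2 by rewrite exprn_gt0.
  have [k' [kk' dk']] := cid (tail p.1.1.2 _ (maxn p.1.2 p.2) e0).
  by exists (p.1.1.2, p.1.1.1 + (s k' - s p.1.2), k', p.2.+1).
have [f [f0 f_next]] := dependent_choice next (0, s 0%N, 0%N, 0%N).
pose y n := (f n).1.1.2; pose k n := (f n).1.2.
have rank n : (f n).2 = n.
  elim: n => [|n IHn]; first by rewrite f0.
  by have [_ _ _ -> _] := f_next n; rewrite IHn.
have y_sum n : y n + y n.+1 = s (k n.+1).
  have sum m : (f m).1.1.1 + y m = s (k m).
    elim: m => [|m IHm]; first by rewrite /y /k f0 /= add0r.
    have [-> e _ _ _] := f_next m.
    rewrite /y e -/(y m) addrA [y m + _]addrC IHm -/(k m) -/(k m.+1).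
    by rewrite addrC subrK.
  by rewrite -(sum n.+1); have [-> _ _ _ _] := f_next n.
have y_step n : d (y n) (y n.+2) < 2^-1 ^+ n.
  have [e1 _ _ _ dn] := f_next n; have [_ e2 kn _ _] := f_next n.+1.
  rewrite {2}/y e2 e1 -[X in _ ^+ X](rank n); apply: dn.
  by move: kn; rewrite geq_max => /andP[].
have k_ge n : (n <= k n.+1)%N.
  by have [_ _ kn _ _] := f_next n; move: kn; rewrite geq_max rank => /andP[].
have pow_le m n : (m <= n)%N -> (2^-1 : R) ^+ n <= 2^-1 ^+ m.
  by move=> mn; rewrite ler_wiXn2l//; lra.
have [g yg] : exists l : M, (fun n => y n.*2) @ \oo --> l.
  apply: (geometric_steps_converge d_metric d_complete) => n.
  by rewrite doubleS (lt_le_trans (y_step _))// pow_le// -addnn leq_addr.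
have [h yh] : exists l : M, (fun n => y n.*2.+1) @ \oo --> l.
  apply: (geometric_steps_converge d_metric d_complete) => n.
  by rewrite doubleS (lt_le_trans (y_step _))// pow_le// leqW// -addnn leq_addr.
have s_sub : (fun n => s (k n.*2.+1)) @ \oo --> g + h.
  under eq_fun do rewrite -y_sum.
  exact: (cvg_comp2 yg yh (@add_continuous M (g, h))).
(* A Cauchy sequence converges to the limit of any convergent subsequence. *)
exists (g + h) => U /nbhs_translate /nbhs0_split[D D0 DU].
have [N sN] := s_cauchy D D0.
have [N' _ subN'] := s_sub _ (nbhs_sub (g + h) D0).
exists N => // m /= Nm.
pose n := maxn N N'.
have Nk : (N <= k n.*2.+1)%N.
  apply: leq_trans (k_ge _); rewrite (leq_trans (leq_maxl N N'))//.
  by rewrite -addnn leq_addr.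
have [+ _] := DU _ _ (subN' n (leq_maxr _ _)) (sN m _ Nm Nk).
by rewrite /= addrA subrKC addrC subrK.
Qed.

(** * Sequences supported in a fixed set [B], against neighbourhoods of 0 *)

Lemma supp_subP (R : realType) (x : nat -> R^o) (A : set nat) :
  supp x `<=` A <-> forall i, ~ A i -> x i = 0.
Proof.
split=> [xA i Ai|xA i /= /eqP xi]; last exact: contra_notP (@xA i) xi.
by apply/eqP; apply: contra_notT Ai => /xA.
Qed.

Lemma suppD_sub (R : realType) (x y : nat -> R^o) (A : set nat) :
  supp x `<=` A -> supp y `<=` A -> supp (x + y) `<=` A.
Proof.
move=> /supp_subP xA /supp_subP yA; apply/supp_subP => i Ai.
by have -> : (x + y) i = x i + y i; rewrite // xA// yA// addr0.
Qed.

Lemma suppZ_sub (R : realType) (c : R) (x : nat -> R^o) (A : set nat) :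
  supp x `<=` A -> supp (c *: x) `<=` A.
Proof.
move=> /supp_subP xA; apply/supp_subP => i Ai.
by have -> : (c *: x) i = c *: x i; rewrite // xA// scaler0.
Qed.

(* A Baire category argument in which neighbourhoods prescribe finitely many
   coordinates exactly: otherwise one builds, coordinate block by coordinate
   block, a sequence supported in [B] that avoids every multiple of [U]. *)
Lemma absorbing_difference_approx (R : realType) (B : set nat)
    (U : set (nat -> R^o)) :
  (forall x : nat -> R^o, supp x `<=` B ->
     exists k : nat, U (k.+1%:R^-1 *: x)) ->
  exists N : nat, forall x : nat -> R^o,
    supp x `<=` B `&` [set i | (N <= i)%N] ->
    forall M : nat, exists a b : nat -> R^o,
      [/\ U a, U b & forall i, (i < M)%N -> a i - b i = x i].
Proof.
move=> U_absorb; apply: contrapT => /forallNP noN.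
(* The first [M] coordinates of [s] alone keep it out of [k.+1] times [U], so changes beyond them
   cannot undo this. *)
pose avoids (k : nat) (s : nat -> R^o) M :=
  forall a, U a -> ~ forall i, (i < M)%N -> k.+1%:R * a i = s i.
have extend k (s : nat -> R^o) N : exists (s' : nat -> R^o) M,
    [/\ (N <= M)%N, avoids k s' M, supp s `<=` B -> supp s' `<=` B &
      forall i, (i < N)%N -> s' i = s i].
  have /existsNP[x /not_implyP[xBN /existsNP[M xM]]] := noN N.
  have [sM|/existsNP[a /not_implyP[Ua /contrapT sa]]] :=
      pselect (avoids k s (maxn N M)).
    by exists s, (maxn N M); split => //; exact: leq_maxl.
  (* Here [k.+1%:R *: a] matches [s]. If some [k.+1%:R *: b] matched the new sequence, [b - a] would
     match [x] below [M], against the choice of [x]. *)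
  exists (s + k.+1%:R *: x), (maxn N M); split; first exact: leq_maxl.
  - move=> b Ub sb; apply: xM; exists b, a; split => // i iM.
    have iNM : (i < maxn N M)%N by rewrite (leq_trans iM)// leq_maxr.
    have := sb _ iNM.
    have -> : (s + k.+1%:R *: x) i = s i + k.+1%:R * x i by [].
    rewrite -(sa _ iNM) => /eqP; rewrite addrC -subr_eq -mulrBr => /eqP.
    by apply: mulfI; rewrite pnatr_eq0.
  - move=> sB; apply: suppD_sub sB _; apply: suppZ_sub.
    by apply: subset_trans xBN _ => i [].
  - move=> i iN; have -> : (s + k.+1%:R *: x) i = s i + k.+1%:R * x i by [].
    by move/supp_subP: xBN => ->; rewrite ?mulr0 ?addr0// => -[_ /=];
      rewrite leqNgt iN.
pose next_rel (p q : (nat -> R^o) * nat * nat) :=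
  [/\ (p.1.2 < q.1.2)%N, avoids p.2 q.1.1 q.1.2,
      supp p.1.1 `<=` B -> supp q.1.1 `<=` B, q.2 = p.2.+1 &
      forall i, (i < p.1.2)%N -> q.1.1 i = p.1.1 i].
have next p : {q | next_rel p q}.
  have /cid[s' /cid[M [pM sM sB ss']]] := extend p.2 p.1.1 p.1.2.+1.
  by exists (s', M, p.2.+1); split => // i ip; apply: ss'; exact: ltnW.
have [f [f0 f_next]] := dependent_choice next (0, 0%N, 0%N).
pose s n := (f n).1.1; pose M n := (f n).1.2.
have rank n : (f n).2 = n.
  elim: n => [|n IHn]; first by rewrite f0.
  by have [_ _ _ -> _] := f_next n; rewrite IHn.
have M_ge n : (n <= M n)%N.
  elim: n => // n IHn; apply: leq_ltn_trans IHn _.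
  by have [] := f_next n.
have sB n : supp (s n) `<=` B.
  elim: n => [|n IHn]; last by have [_ _ + _ _] := f_next n; exact.
  by rewrite /s f0; apply/supp_subP.
have M_homo m n : (m <= n)%N -> (M m <= M n)%N.
  move=> /subnK <-; elim: (n - m)%N => // j IHj; rewrite addSn (leq_trans IHj)//.
  by apply: ltnW; have [] := f_next (j + m)%N.
have s_stable m n i : (m <= n)%N -> (i < M m)%N -> s n i = s m i.
  move=> /subnK <- iM; elim: (n - m)%N => // j <-; rewrite addSn.
  have [_ _ _ _] := f_next (j + m)%N; apply.
  by apply: leq_trans iM _; apply: M_homo; exact: leq_addl.
(* Coordinate [i] is final from stage [i.+1] on, since [i < M i.+1]. *)
pose x : nat -> R^o := fun i => s i.+1 i.
have x_stable n i : (i < M n)%N -> x i = s n i.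
  move=> iM; have [ni|/ltnW ni] := leqP n i.+1; first exact: s_stable.
  by rewrite (s_stable i.+1 n i ni)// M_ge.
have xB : supp x `<=` B by move=> i; exact: sB.
have [k Uk] := U_absorb x xB.
have [_ + _ _ _] := f_next k; rewrite rank => /(_ _ Uk); apply => i iM.
rewrite -/(s k.+1) -(x_stable k.+1)//.
have -> : (k.+1%:R^-1 *: x) i = k.+1%:R^-1 * x i by [].
by rewrite mulVKf// pnatr_eq0.
Qed.

(** Scaling is continuous at [(0, z)] and the harmonic sequence tends to 0. Countably many scalars
    let the block construction above treat one per stage. *)
Lemma nbhs0_absorbing (R : realType) (E : topologicalLmodType R) (U : set E)
    (z : E) :
  nbhs 0 U -> exists k : nat, U (k.+1%:R^-1 *: z).
Proof.
move=> U0; have /= := @scale_continuous R E (0, z) U; rewrite scale0r.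
move=> /(_ U0)[[P Q] [/= P0 Qz] PQ].
have [k _ Pk] := @cvg_harmonic R P P0.
exists k; apply: (PQ (k.+1%:R^-1, z)); split => /=; last exact: nbhs_singleton.
by apply: Pk => /=.
Qed.

(** A small vector of [E] can match any finite number of coordinates of a sequence supported far out
    in [B]. Correcting the remainder again and again, with ever smaller vectors, gives a Cauchy
    series whose sum lies in [U] and is mapped to [x]. *)
Lemma tail_supported_in_nbhs0 (R : realType) (E : topologicalLmodType R)
    (phi : {linear E -> (nat -> R^o)}) (B : set nat) (U : set E) :
  completely_metrizable R E ->
  (forall i, continuous (fun z => phi z i)) ->
  (forall x : nat -> R^o, supp x `<=` B -> exists z, phi z = x) ->
  nbhs 0 U ->
  exists N : nat, forall x : nat -> R^o,
    supp x `<=` B `&` [set i | (N <= i)%N] ->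
    exists2 z, U z & phi z = x.
Proof.
move=> E_metr phi_cont phi_onto U0.
have [W [W0 W_base]] : exists W : nat -> set E,
    (forall k, nbhs 0 (W k)) /\ forall A, nbhs 0 A -> exists k, W k `<=` A.
  have [d [_ d_nbhs _]] := E_metr.
  exists (fun k => [set z | d 0 z < 2^-1 ^+ k]); split=> [k|A].
    by rewrite d_nbhs; exists (2^-1 ^+ k) => //=; rewrite exprn_gt0.
  rewrite d_nbhs => -[e /= e0 eA].
  have [k _ small] := near_infty_natSinv_expn_lt (PosNum e0).
  have {small} /= := small k (leqnn k); rewrite div1r -exprVn => small.
  by exists k => z /= dz; apply: eA; exact: lt_trans small.
have [h hP] : {h : set E -> set E & forall A, nbhs 0 A ->
    nbhs 0 (h A) /\ forall a b, h A a -> h A b -> A (a + b) /\ A (a - b)}.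
  apply: (@choice _ _ (fun A D => nbhs 0 A ->
    nbhs 0 D /\ forall a b, D a -> D b -> A (a + b) /\ A (a - b))) => A.
  have [/nbhs0_split[D D0 DA]|nA] := pselect (nbhs 0 A); first by exists D.
  by exists setT.
(* Since [V k.+1 + V k.+1] lies in [V k], a finite sum of terms from [V m.+1], [V m.+2], and so on,
   one from each, stays in [V m]. Intersecting with [W k] makes the [V k] a base at 0. *)
pose V := fix V k := if k is k'.+1 then h (V k' `&` W k') else h U.
have V0 k : nbhs 0 (V k).
  elim: k => [|k IHk]; first by have [] := hP U U0.
  by have [] := hP (V k `&` W k) (filterI IHk (W0 k)).
have V_add k a b : V k.+1 a -> V k.+1 b -> (V k `&` W k) (a + b).
  have [_ hVW] := hP _ (filterI (V0 k) (W0 k)) => Va Vb.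
  by have [] := hVW a b Va Vb.
have V_W k : V k.+1 `<=` W k.
  move=> a Va; have [_] := V_add k a 0 Va (nbhs_singleton (V0 _)).
  by rewrite addr0.
have [N NP] : {N : nat -> nat & forall k (r : nat -> R^o),
    supp r `<=` B `&` [set i | (N k <= i)%N] -> forall M, exists u,
    [/\ V k.+1 u, supp (phi u) `<=` B & forall i, (i < M)%N -> phi u i = r i]}.
  apply: (@choice _ _ (fun k N => forall r : nat -> R^o,
    supp r `<=` B `&` [set i | (N <= i)%N] -> forall M, exists u,
    [/\ V k.+1 u, supp (phi u) `<=` B & forall i, (i < M)%N -> phi u i = r i])).
  move=> k; have [hV0 hV] := hP _ (V0 k.+1).
  have [|N NP] := @absorbing_difference_approx R B
      [set x | supp x `<=` B /\ exists2 z, h (V k.+1) z & phi z = x].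
    move=> x xB; have [z zx] := phi_onto x xB.
    have [n hn] := nbhs0_absorbing z hV0; exists n; split.
      exact: suppZ_sub.
    by exists (n.+1%:R^-1 *: z); rewrite // linearZ zx.
  exists N => r rB M.
  have [a [b [[aB [a' ha aE]] [bB [b' hb bE]] abr]]] := NP r rB M.
  exists (a' - b'); rewrite linearB aE bE; split => //.
    by have [] := hV a' b' ha hb.
  by rewrite -scaleN1r; apply: suppD_sub aB _; exact: suppZ_sub.
(* The summand [k] forces the supports of the remainders to move to infinity. *)
pose K k := (k + N k)%N.
have [u uP] : {u : nat * (nat -> R^o) -> E & forall kr,
    supp kr.2 `<=` B `&` [set i | (K kr.1 <= i)%N] ->
    V kr.1.+1 (u kr) /\
    supp (kr.2 - phi (u kr)) `<=` B `&` [set i | (K kr.1.+1 <= i)%N]}.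
  apply: (@choice _ _ (fun kr v =>
    supp kr.2 `<=` B `&` [set i | (K kr.1 <= i)%N] ->
    V kr.1.+1 v /\
    supp (kr.2 - phi v) `<=` B `&` [set i | (K kr.1.+1 <= i)%N])) => -[k r] /=.
  have [rBK|] := pselect (supp r `<=` B `&` [set i | (K k <= i)%N]);
    last by exists 0.
  have [|v [Vv vB vr]] := NP k r _ (K k.+1).
    by move=> i /rBK[Bi /= Ki]; split => //=; rewrite (leq_trans _ Ki)// leq_addl.
  exists v => _; split=> // i ri; split.
    have : supp (r + (-1) *: phi v) `<=` B.
      by apply: suppD_sub; [move=> j /rBK[]|exact: suppZ_sub].
    by apply; rewrite scaleN1r.
  rewrite /= leqNgt; apply/negP => iK; have : r i - phi v i != 0 := ri.
  by rewrite vr// subrr eqxx.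
(* Subtracting [u (k, r k)] from the remainder [r k] makes its first [K k.+1]
   coordinates vanish, so that [x] is the coordinatewise sum of the [u]'s. *)
exists (K 0%N) => x xBK.
pose r := fix r k := if k is k'.+1 then r k' - phi (u (k', r k')) else x.
have rBK k : supp (r k) `<=` B `&` [set i | (K k <= i)%N].
  by elim: k => // k IHk; have [] := uP (k, r k) IHk.
have Vu k : V k.+1 (u (k, r k)) by have [] := uP (k, r k) (rBK k).
pose z k := \sum_(j < k) u (j : nat, r j).
have zS k : z k.+1 = z k + u (k, r k) by rewrite /z big_ord_recr.
have phi_z k : phi (z k) = x - r k.
  elim: k => [|k IHk]; first by rewrite /z big_ord0 linear0 subrr.
  by rewrite zS linearD IHk /= opprB addrA addrAC.
(* The induction peels off the first term [u (m, r m)]: the remaining block lies in [V m.+1] by the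
   hypothesis at [m.+1]. *)
have z_tail m n : V m (z (m + n)%N - z m).
  elim: n m => [|n IHn] m.
    by rewrite addn0 subrr; exact: nbhs_singleton (V0 m).
  have [+ _] := V_add m _ _ (IHn m.+1) (Vu m).
  by rewrite zS addnS addSn opprD addrA subrK.
have z_cauchy : additively_cauchy z.
  move=> A /nbhs0_split[D D0 DA]; have [k WD] := W_base D D0.
  exists k.+1 => m n /subnKC <- /subnKC <-.
  have [_] := DA _ _ (WD _ (V_W _ _ (z_tail k.+1 (m - k.+1)%N)))
                     (WD _ (V_W _ _ (z_tail k.+1 (n - k.+1)%N))).
  by rewrite opprB addrA subrK.
have [l zl] := completely_metrizable_cauchy_cvg E_metr z_cauchy.
exists l.
  (* For large [n], [l] is the difference of [z n] and [z n - l], both in [V 0]. *)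
  have [n _ /(_ n (leqnn n))/= Vl] := zl _ (nbhs_sub l (V0 0%N)).
  have [_ hU] := hP U U0.
  have := z_tail 0%N n; rewrite /z big_ord0 subr0 add0n -/(z n) => Vz.
  by have [_] := hU _ _ Vz Vl; rewrite opprB addrC subrK.
apply/funext => i.
have lim1 : (fun n => phi (z n) i) @ \oo --> phi l i.
  exact: (cvg_comp _ _ zl (phi_cont i l)).
have lim2 : (fun n => phi (z n) i) @ \oo --> x i.
  apply: cvg_near_cst; exists i.+1 => // n /= ni.
  rewrite phi_z; have -> : (x - r n) i = x i - r n i by [].
  move: (rBK n) => /supp_subP ->; rewrite ?subr0// => -[_ /=].
  by rewrite leqNgt (leq_trans ni)// leq_addr.
exact: (cvg_unique (@norm_hausdorff _ _) lim1 lim2).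
Qed.

(** * Lines in neighbourhoods of 0 and the series of unit sequences *)

Lemma convex_lines_sum (R : numFieldType) (E : lmodType R) (C : set E)
    (e : nat -> E) (N : nat) :
  convex_set C -> (forall n, (N <= n)%N -> forall t, C (t *: e n)) ->
  forall (m k : nat) (t : nat -> R), (N <= m)%N ->
    C (\sum_(m <= i < m + k) t i *: e i).
Proof.
move=> C_convex lines m k t Nm.
have mid a b : C a -> C b -> C (2^-1 *: a + 2^-1 *: b).
  move=> Ca Cb; have h0 : 0 <= (2^-1 : R) by rewrite invr_ge0 ler0n.
  have h1 : (2^-1 : R) <= 1 by rewrite invf_le1 ?ltr0n// ler1n.
  have /set_mem := C_convex a b (Itv01 h0 h1) (mem_set Ca) (mem_set Cb).
  have half : 1 - 2^-1 = 2^-1 :> R by rewrite [X in X - _]splitr div1r addrK.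
  by rewrite -[in X in _ + X *: _]half.
elim: k t => [|k IHk] t.
  by rewrite addn0 big_geq//; have := lines m Nm 0; rewrite scale0r.
rewrite addnS big_nat_recr ?leq_addr//=.
(* The longer sum is the midpoint of twice the shorter sum and twice the last term; doubling is
   harmless because the coefficients are arbitrary. *)
have double_half (v : E) a : a *: v = 2^-1 *: ((2 * a) *: v).
  by rewrite scalerA mulKf// pnatr_eq0.
rewrite (eq_bigr _ (fun i _ => double_half (e i) (t i))) double_half -scaler_sumr.
apply: mid; first exact: IHk.
by apply: lines; rewrite (leq_trans Nm)// leq_addr.
Qed.

Lemma infinite_unbounded (A : set nat) (N : nat) :
  infinite_set A -> exists2 n, A n & (N <= n)%N.
Proof.
move=> A_inf; apply: contrapT => noA; apply: A_inf.
apply: sub_finite_set (finite_II N) => n An /=.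
by rewrite ltnNge; apply/negP => Nn; apply: noA; exists n.
Qed.

Lemma finite_bounded (A : set nat) :
  finite_set A -> exists N, forall n, (N <= n)%N -> ~ A n.
Proof.
move=> /finite_seqP[s ->]; exists (\max_(i <- s) i).+1 => n + /= ns.
by rewrite ltnNge (leq_bigmax_seq n ns).
Qed.

Definition delta (R : realType) (n : nat) : nat -> R^o :=
  fun i => (i == n)%:R.

Lemma supp_scale_delta (R : realType) (t : R) (n : nat) :
  supp (t *: delta R n) `<=` [set n].
Proof.
apply: suppZ_sub; apply/supp_subP => i /= /eqP.
by rewrite /delta => /negbTE ->.
Qed.

(** An infinite member of [I] made of exceptional indices would, by [tail_supported_in_nbhs0],
    contain an [n] such that each [t *: delta R n] has a preimage in [U]. By injectivity this
    preimage is [t *: e n], so [n] is not exceptional. *)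
Lemma lines_in_nbhs0 (R : realType) (I : set_system nat)
    (E : topologicalLmodType R) (phi : {linear E -> (nat -> R^o)})
    (e : nat -> E) (U : set E) :
  is_ideal I -> tall I ->
  completely_metrizable R E -> injective phi ->
  (forall i, continuous (fun z => phi z i)) ->
  (forall x, c00 R I x -> exists z, phi z = x) ->
  (forall n, phi (e n) = delta R n) ->
  nbhs 0 U ->
  exists N, forall n, (N <= n)%N -> forall t, U (t *: e n).
Proof.
move=> [_ I_sub _ _] I_tall E_metr phi_inj phi_cont phi_onto phi_e U0.
have [|bad_inf] := pselect (finite_set [set n | ~ forall t, U (t *: e n)]).
  by move/finite_bounded => [N NP]; exists N => n /NP /contrapT.
have [B [B_bad B_inf IB]] := I_tall _ bad_inf.
have [|N NP] := tail_supported_in_nbhs0 E_metr phi_cont (B := B) _ U0.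
  by move=> x xB; apply: phi_onto; exact: I_sub xB IB.
have [n Bn Nn] := infinite_unbounded N B_inf.
exfalso; apply: (B_bad n Bn) => t.
have [|z Uz] := NP (t *: delta R n).
  by move=> i /supp_scale_delta ->.
by rewrite -phi_e -linearZ => /phi_inj <-.
Qed.

Lemma tall_c00_onto (R : realType) (I : set_system nat)
    (E : topologicalLmodType R) (phi : {linear E -> (nat -> R^o)}) :
  is_ideal I -> tall I ->
  (exists2 C : set_system E, (forall b, b \in C -> convex_set b) & basis C) ->
  completely_metrizable R E -> injective phi ->
  (forall i, continuous (fun z => phi z i)) ->
  (forall x, c00 R I x -> exists z, phi z = x) ->
  forall x, exists z, phi z = x.
Proof.
move=> I_ideal I_tall [C C_convex [C_open C_basis]] E_metr phi_inj phi_cont.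
move=> phi_onto x.
have [e phi_e] : {e : nat -> E & forall n, phi (e n) = delta R n}.
  apply: (@choice _ _ (fun n z => phi z = delta R n)) => n; apply: phi_onto.
  have [_ I_sub _ I_fin] := I_ideal; apply: I_sub (I_fin _ (finite_set1 n)).
  by rewrite -[delta R n]scale1r; exact: supp_scale_delta.
pose s n := \sum_(0 <= i < n) x i *: e i.
have phi_s n i : (i < n)%N -> phi (s n) i = x i.
  move=> iN; have -> : phi (s n) i = \sum_(0 <= j < n) x j * (i == j)%:R.
    rewrite /s linear_sum fct_sumE; apply: eq_bigr => j _.
    by rewrite linearZ phi_e.
  rewrite (bigD1_seq i) ?mem_index_iota ?iota_uniq//= eqxx mulr1.
  by rewrite big1 ?addr0// => j /negbTE; rewrite eq_sym => ->; rewrite mulr0.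
have s_cauchy : additively_cauchy s.
  move=> U /C_basis[b [Cb b0] bU].
  have b_nbhs : nbhs 0 b by apply: open_nbhs_nbhs; split => //; exact: C_open.
  have [N lines] := lines_in_nbhs0 I_ideal I_tall E_metr phi_inj phi_cont
    phi_onto phi_e b_nbhs.
  have b_sum := convex_lines_sum (C_convex _ (mem_set Cb)) lines.
  exists N => m n Nm Nn; apply: bU; have [mn|/ltnW nm] := leqP m n.
    (* For [m <= n] the difference is minus a block of the series. The sign goes into the
       coefficients, as [b] need not be symmetric. *)
    have := b_sum m (n - m)%N (fun i => - x i) Nm; rewrite subnKC//.
    under eq_bigr do rewrite scaleNr.
    rewrite sumrN /s [in X in _ - X](big_cat_nat (leq0n _) mn)//=.
    by rewrite opprD addrA subrr add0r.
  have := b_sum n (m - n)%N x Nn; rewrite subnKC//.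
  by rewrite /s [in X in X - _](big_cat_nat (leq0n _) nm)//= addrAC subrr add0r.
have [l sl] := completely_metrizable_cauchy_cvg E_metr s_cauchy.
exists l; apply/funext => i.
have lim1 : (fun n => phi (s n) i) @ \oo --> phi l i.
  exact: (cvg_comp _ _ sl (phi_cont i l)).
have lim2 : (fun n => phi (s n) i) @ \oo --> x i.
  by apply: cvg_near_cst; exists i.+1 => // n /= ni; exact: phi_s.
exact: (cvg_unique (@norm_hausdorff _ _) lim1 lim2).
Qed.

Theorem theorem2p1 (R : realType) (I : set_system nat)
    (V : submodClosed (nat -> R^o))
    (I_ideal : is_ideal I) (I_tall : tall I)
    (V_proper : [set` V] <> [set: nat -> R^o])
    (V_c00 : c00 R I `<=` [set` V]) :
  ~ admits_locally_convex_FK V.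
Proof.
move=> [tau [[addC scaleC convex] metr val_cont]]; apply: V_proper.
(* The continuity of the operations turns [V] with [tau] into a topological vector space, on which
   [phi] is the inclusion. *)
pose E : topologicalLmodType R := HB.pack (topologized tau)
  (PreTopologicalNmodule_isTopologicalNmodule.Build (topologized tau) addC)
  (TopologicalNmodule_isTopologicalLmodule.Build R (topologized tau) scaleC).
pose phi : E -> (nat -> R^o) := fun z => \val (z : subspace_carrier V).
have phi_linear : linear phi by move=> a u v.
pose phiL : {linear E -> (nat -> R^o)} :=
  HB.pack phi (GRing.isLinear.Build _ _ _ _ phi phi_linear).
have phi_cont i : continuous (fun z : E => phiL z i).
  move=> z.
  exact: (cvg_comp _ _ (val_cont z)
    (@proj_continuous nat (fun=> R^o) i (\val z))).
have phi_onto x : c00 R I x -> exists z, phiL z = x.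
  by move=> /V_c00 xV; exists (exist _ x xV).
have onto := @tall_c00_onto R I E phiL I_ideal I_tall convex metr val_inj
  phi_cont phi_onto.
apply/seteqP; split => // x _ /=.
by have [z <-] := onto x; exact: (valP (z : subspace_carrier V)).
Qed.
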